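(* Let $\mathcal{H}$ be a complex Hilbert space and let $A\in\mathcal{B}(\mathcal{H})$. Then $$\frac14\|A^*A+AA^*\|\le\frac{1}{4\sqrt2}\left[\|A+A^*\|^4+\|A-A^*\|^4\right]^{1/2}\le w^2(A).$$
   Context: $\mathcal{B}(\mathcal{H})$ is the set of bounded linear operators on $\mathcal{H}$, $A^*$ is the adjoint of $A$, and $\|\cdot\|$ is the operator norm. The numerical radius is $w(A)=\sup\{|\langle Ax,x\rangle| : x\in\mathcal{H},\ \|x\|=1\}$, and $w^2(A)=(w(A))^2$. *)

(* Defs.v *)
From HB Require Import structures.
From mathcomp Require Import all_boot all_order all_algebra.
From mathcomp Require Import all_classical all_reals all_analysis.
From mathcomp Require Import complex ring lra.

Set Implicit Arguments.
Unset Strict Implicit.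
Unset Printing Implicit Defensive.

Import Order.TTheory GRing.Theory Num.Theory.
Import numFieldNormedType.Exports.

Local Open Scope classical_set_scope.
Local Open Scope ring_scope.

(* [inner] is linear in its first argument and conjugate-linear in its second. *)
HB.mixin Record CompleteNormedModule_isHilbert (R : realType) H
    of CompleteNormedModule R[i] H := {
  inner : {dot H for Num.conj};
  sqr_norm_inner : forall x : H, `|x| ^+ 2 = inner x x
}.

#[short(type="hilbertType")]
HB.structure Definition Hilbert (R : realType) :=
  {H of CompleteNormedModule_isHilbert R H & CompleteNormedModule R[i] H}.

Section operators.
Variables (R : realType) (H : hilbertType R).
Implicit Types A : H -> H.

Definition bounded_operator A : Prop :=
  exists M : R, forall x : H, `|A x| <= (M%:C)%C * `|x|.

(* The norm of [H] takes its values in [R[i]]; they are real, so [complex.Re]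
   only moves them to [R]. *)
Definition opnorm A : R :=
  sup [set complex.Re `|A x| | x in [set x : H | `|x| <= 1]].

Definition numradius A : R :=
  sup [set complex.Re `|inner (A x) x| | x in [set x : H | `|x| = 1]].

Definition adjoint A (y : H) : H :=
  xget 0 [set z : H | forall x : H, inner (A x) y = inner x z].

End operators.

(* Riesz representation: for a bounded linear [A] the set in [adjoint] is
   nonempty, hence the default value [0] is never used (see [adjointP]).
   The vector representing [phi] is the limit of the minimizing sets of
   [x |-> |x|^2 - 2 Re (phi x)]. *)
Section adjoint_exists.
Variables (R : realType) (H : hilbertType R).
Local Notation C := R[i].
Implicit Types x y u : H.

Lemma Re_le (a b : C) : a <= b -> complex.Re a <= complex.Re b.
Proof. by rewrite lecE => /andP[]. Qed.

Lemma normRe x : (complex.Re `|x|)%:C%C = `|x| :> C.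
Proof. exact/RRe_real/normr_real. Qed.

Lemma conjD_Re (a : C) : a + a^* = 2 * (complex.Re a)%:C%C.
Proof. exact: addcJ. Qed.

Lemma inner_conj x y : inner y x = (inner x y)^*.
Proof. by rewrite hermC expr0 mul1r. Qed.

Lemma innerDZl x y (t : C) u : inner (x + t *: y) u = inner x u + t * inner y u.
Proof. by rewrite linearDl linearZl_LR. Qed.

Lemma innerDZr x y (t : C) u :
  inner u (x + t *: y) = inner u x + t^* * inner u y.
Proof. by rewrite linearDr linearZr_LR. Qed.

Lemma cauchy_schwarz x y : `|inner x y| <= `|x| * `|y|.
Proof.
rewrite -(ler_pXn2r (n := 2)) ?nnegrE ?mulr_ge0// exprMn !sqr_norm_inner.
have [->|y0] := eqVneq y 0.
  by rewrite !linear0r normr0 expr0n.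
have yy0 : 0 < inner y y by rewrite dnorm_gt0.
have := dnorm_ge0 inner (x + (- inner x y / inner y y) *: y).
suff -> : inner (x + (- inner x y / inner y y) *: y)
    (x + (- inner x y / inner y y) *: y) =
    inner x x - `|inner x y| ^+ 2 / inner y y.
  by rewrite subr_ge0 ler_pdivrMr.
rewrite !(innerDZl, innerDZr) (inner_conj x y) normCK.
rewrite !(rmorphM, rmorphN, fmorphV) /= -!inner_conj.
by field; rewrite gt_eqF.
Qed.

Section riesz.
Variables (phi : H -> C) (M : R).
Hypothesis phiDZ : forall x (t : C) u, phi (x + t *: u) = phi x + t * phi u.
Hypothesis phiM : forall x, `|phi x| <= M%:C%C * `|x|.

Let G x : C := inner x x - (phi x + (phi x)^*).

Let GE x (t : C) u : let w := inner u x - phi u in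
  G (x + t *: u) = G x + t * t^* * inner u u + (t * w + (t * w)^*).
Proof.
rewrite /G /= phiDZ !(innerDZl, innerDZr) (inner_conj u x).
by rewrite !(rmorphD, rmorphM, rmorphN, rmorphB) /= ?conjCK; ring.
Qed.

Let phi0 : phi 0 = 0.
Proof.
by have := phiDZ 0 (-1) 0; rewrite scaler0 addr0 mulN1r subrr.
Qed.

Let conj_half : (2^-1 : C)^* = 2^-1.
Proof. by rewrite fmorphV /= rmorph_nat. Qed.

Let parallelogram x y :
  `|x - y| ^+ 2 = 2 * (G x + G y) - 4 * G (x + 2^-1 *: (y - x)).
Proof.
rewrite sqr_norm_inner GE /G.
have -> : x - y = x + (-1) *: y by rewrite scaleN1r.
have -> : y - x = y + (-1) *: x by rewrite scaleN1r.
rewrite !phiDZ !(innerDZl, innerDZr) (inner_conj x y).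
rewrite !(rmorphD, rmorphM, rmorphN, rmorphB) /= ?conjCK conj_half !rmorph1.
rewrite -!inner_conj.
by field.
Qed.

Let Greal x : G x = (complex.Re (G x))%:C%C.
Proof.
rewrite RRe_real // /G rpredB //; first exact/ger0_real/dnorm_ge0.
by apply/CrealP; rewrite rmorphD /= conjCK addrC.
Qed.

Let Glb x : - (M ^+ 2) <= complex.Re (G x).
Proof.
have /Re_le := phiM x; have /Re_le := normc_ge_Re (phi x).
have -> : G x = (complex.Re `|x| ^+ 2 - 2 * complex.Re (phi x))%:C%C.
  rewrite /G -sqr_norm_inner conjD_Re -[in LHS](normRe x).
  by rewrite rmorphB rmorphXn rmorphM rmorph_nat.
rewrite -[in X in _ -> X -> _](normRe x) -rmorphM /=.
move: (complex.Re `|x|) (complex.Re `|phi x|) (complex.Re (phi x)) => r p q.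
move=> /(le_trans (ler_norm _)) qp pr.
have := sqr_ge0 (r - M); nra.
Qed.

Let E := range (fun x => complex.Re (G x)).
Let m := inf E.
Let S (e : R) : set H := [set x | complex.Re (G x) < m + e].

Let hiE : has_inf E.
Proof.
split; first by exists (complex.Re (G 0)), 0.
by exists (- M ^+ 2) => _ [x _ <-]; exact: Glb.
Qed.

Let m_le x : m <= complex.Re (G x).
Proof. by apply: ge_inf; [exact: hiE.2|exists x]. Qed.

Let S0 (e : R) : 0 < e -> S e !=set0.
Proof.
move=> e0; have [_ [x _ <-] xe] := inf_adherent e0 hiE; by exists x.
Qed.

Let Sdiam (e : R) x y : S e x -> S e y -> `|x - y| ^+ 2 <= (4 * e)%:C%C.
Proof.
rewrite /S /= => xe ye; rewrite parallelogram.
have mh := m_le (x + 2^-1 *: (y - x)).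
rewrite (Greal x) (Greal y) (Greal (_ + _)).
move: (complex.Re (G (_ + _))) (complex.Re (G x)) (complex.Re (G y)) mh xe ye.
move=> c a b mh xe ye.
rewrite -[2](rmorph_nat (real_complex R)) -[4](rmorph_nat (real_complex R)).
by rewrite -rmorphD -!rmorphM -rmorphB lecR /=; lra.
Qed.

Let Sphi (e : R) x u : S e x -> `|inner u x - phi u| ^+ 2 <= e%:C%C * `|u| ^+ 2.
Proof.
have [->|u0] := eqVneq u 0.
  by rewrite linear0l phi0 subr0 !normr0 expr0n mulr0.
rewrite /S /= => xe; set w := inner u x - phi u.
have uu0 : 0 < inner u u by rewrite dnorm_gt0.
pose t : C := - w^* / inner u u.
have := GE x t u; rewrite -/w /= -addrA.
have -> : t * t^* * inner u u + (t * w + (t * w)^*) = - (`|w| ^+ 2 / inner u u).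
  rewrite /t !(rmorphM, rmorphN, fmorphV) /= !conjCK -!inner_conj normCK.
  by field; rewrite gt_eqF.
move=> Gt; rewrite sqr_norm_inner -ler_pdivrMr//.
have -> : `|w| ^+ 2 / inner u u = G x - G (x + t *: u) by rewrite Gt; ring.
rewrite (Greal x) (Greal (_ + _)) -rmorphB lecR /=.
have := m_le (x + t *: u); lra.
Qed.

Lemma riesz : exists z, forall u, phi u = inner u z.
Proof.
pose F := filter_from [set e : R | 0 < e] S.
have FF : ProperFilter F.
  apply: filter_from_proper; last by move=> e; exact: S0.
  apply: filter_from_filter; first by exists 1 => /=.
  move=> a b a0 b0; exists (Order.min a b); first by rewrite /= lt_min a0.
  move=> x; rewrite /S /= => xab; split; apply: (lt_le_trans xab).
    by rewrite lerD2l ge_min lexx.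
  by rewrite lerD2l ge_min lexx orbT.
have : cauchy F.
  apply/cauchy_ballP => e e0.
  have eE : e = (complex.Re e)%:C%C by rewrite RRe_real// gtr0_real.
  have r0 : 0 < complex.Re e by rewrite -ltcR -eE.
  pose d := (complex.Re e / 4) ^+ 2.
  have d0 : 0 < d by rewrite exprn_gt0// divr_gt0.
  exists (S d, S d); first by split; exists d.
  move=> [x y] [/= xd yd]; rewrite -ball_normE /=.
  have := Sdiam xd yd; rewrite -(ltr_pXn2r (n := 2)) ?nnegrE//; last exact: ltW.
  move=> /le_lt_trans; apply.
  by rewrite eE -rmorphXn ltcR /d /=; nra.
move=> /cauchy_cvg Fz; exists (lim F) => u.
set w := `|phi u - inner u (lim F)|.
have key (e : R) : 0 < e -> w <= (2 * e)%:C%C * `|u|.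
  move=> e0.
  have Fe : F (ball (lim F) e%:C%C) by apply: Fz; apply: nbhsx_ballx; rewrite ltcR.
  have FS : F (S (e ^+ 2)) by exists (e ^+ 2) => //; rewrite /= exprn_gt0.
  have [x [xe xS]] := filter_ex (filterI Fe FS).
  rewrite /w; have -> : phi u - inner u (lim F) =
      - (inner u x - phi u) - inner u (lim F - x) by rewrite linearBr; ring.
  rewrite rmorphM rmorph_nat -mulrA mulr2n mulrDl mul1r.
  apply: (le_trans (ler_normB _ _)); rewrite normrN; apply: lerD.
    rewrite -(ler_pXn2r (n := 2)) ?nnegrE ?mulr_ge0//; last by rewrite lecR ltW.
    have -> : (e%:C%C * `|u|) ^+ 2 = (e ^+ 2)%:C%C * `|u| ^+ 2.
      by rewrite exprMn; congr (_ * _); rewrite rmorphXn.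
    exact: Sphi.
  apply: (le_trans (cauchy_schwarz _ _)); rewrite mulrC ler_wpM2r//.
  by move: xe; rewrite -ball_normE /= => /ltW.
apply/eqP; rewrite -subr_eq0 -normr_le0 -/w -[w]RRe_real ?normr_real// lecR.
apply/ler_addgt0Pl => e e0; rewrite addr0.
set b : R := complex.Re `|u|.
have b0 : 0 <= b by rewrite -ler0c normRe.
have /key/Re_le : 0 < e / (2 * b + 1) by rewrite divr_gt0// ltr_wpDl// mulr_ge0.
rewrite -[X in _ * X]normRe -rmorphM /= => /le_trans; apply.
have -> : 2 * (e / (2 * b + 1)) * b = e * (2 * b / (2 * b + 1)) by ring.
apply: ler_piMr; first exact: ltW.
by rewrite ler_pdivrMr ?mul1r; lra.
Qed.

End riesz.

Lemma adjointP (A : {linear H -> H}) : bounded_operator A ->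
  forall x y : H, inner (A x) y = inner x (adjoint A y).
Proof.
move=> [M AM] x y.
suff [z Az] : exists z, forall x, inner (A x) y = inner x z.
  by move: x; rewrite /adjoint; case: xgetP => [_ _ ? // | /(_ z)].
apply: (@riesz (fun x => inner (A x) y) (M * complex.Re `|y|)).
  by move=> a t u; rewrite linearD linearZ innerDZl.
move=> a; apply: (le_trans (cauchy_schwarz _ _)).
have -> : (M * complex.Re `|y|)%:C%C * `|a| = M%:C%C * `|a| * `|y|.
  by rewrite -[in RHS](normRe y) rmorphM; ring.
by rewrite ler_wpM2r.
Qed.

End adjoint_exists.

(* Main.v *)
(** Write [B] for the adjoint of [A], [S = A + B] and [D = A - B]. Since [S] is
    symmetric and [D] is skew, [<Sx, Sy> + <Dx, Dy> = 2 <(B A + A B) x, y>],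
    hence [||B A + A B|| <= (||S||^2 + ||D||^2) / 2]; the first inequality is
    then the comparison of the arithmetic and quadratic means of [||S||^2] and
    [||D||^2]. The norm of a symmetric operator is bounded by its numerical
    radius; applied to [S] and [iD] this gives [||S||, ||D|| <= 2 w(A)], hence
    the second inequality. *)
Require Import Defs.
From mathcomp Require Import all_boot all_order all_algebra.
From mathcomp Require Import all_classical all_reals all_analysis.
From mathcomp Require Import complex.
From mathcomp Require Import ring lra.

Import Order.TTheory GRing.Theory Num.Theory.
Import numFieldNormedType.Exports.

Local Open Scope classical_set_scope.
Local Open Scope ring_scope.

Section operator_norms.
Context {R : realType} {H : hilbertType R}.
Local Notation C := R[i].
Implicit Types (T : H -> H) (x y : H).

(** * Symmetric maps and their quadratic forms *)

Lemma innerZl (t : C) x y : inner (t *: x) y = t * inner x y.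
Proof. by rewrite linearZl_LR. Qed.

Lemma innerZr (t : C) x y : inner x (t *: y) = t^* * inner x y.
Proof. by rewrite linearZr_LR. Qed.

(** For [u] and [v] equal to [x] plus and minus [r *: T x], symmetry makes the forms at [u] and [v]
    differ by [4 * |x| * |T x|], while the parallelogram law bounds this by [c * 4 * |x| ^+ 2]. *)
Lemma symmetric_norm_le T (c : C) :
  (forall x y, inner (T x) y = inner x (T y)) ->
  (forall x, `|inner (T x) x| <= c * `|x| ^+ 2) ->
  forall x, `|T x| <= c * `|x|.
Proof.
move=> Tsym Tc x.
have [->|x0] := eqVneq x 0.
  (* [T] is a mere function, so [T 0 = 0] is derived from symmetry. *)
  have : `|T 0| ^+ 2 = 0 by rewrite sqr_norm_inner Tsym linear0l.
  by move/eqP; rewrite sqrf_eq0 => /eqP ->; rewrite normr0 mulr0.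
have nx0 : 0 < `|x| by rewrite normr_gt0.
have c0 : 0 <= c.
  by rewrite -(pmulr_lge0 _ (exprn_gt0 2 nx0)) (le_trans _ (Tc x)).
have [->|Tx0] := eqVneq (T x) 0; first by rewrite normr0 mulr_ge0.
have nTx0 : 0 < `|T x| by rewrite normr_gt0.
(* Polarization at [x] and [r T x], with [r] chosen so that both have the same
   norm. *)
pose r : C := `|x| / `|T x|.
have rC : r^* = r by apply/CrealP; rewrite ger0_real// divr_ge0.
have rTx : r * `|T x| = `|x| by rewrite mulfVK// gt_eqF.
pose u := x + r *: T x; pose v := x + (- r) *: T x.
(* Symmetry moves [T] off the sum and onto [x] and [T x], so the form expands without additivity of
   [T]. *)
have quadE (t : C) : t^* = t -> inner (T (x + t *: T x)) (x + t *: T x) =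
    inner (T x) x + 2 * t * `|T x| ^+ 2 + t ^+ 2 * inner (T (T x)) (T x).
  move=> tC; rewrite sqr_norm_inner innerDZr !(Tsym (x + _)) !innerDZl tC.
  by rewrite -!Tsym !(Tsym (T x)); ring.
have normE (t : C) : t^* = t -> `|x + t *: T x| ^+ 2 =
    `|x| ^+ 2 + t * (inner x (T x) + inner (T x) x) + t ^+ 2 * `|T x| ^+ 2.
  by move=> tC; rewrite !sqr_norm_inner innerDZr !innerDZl tC; ring.
have NrC : (- r)^* = - r by rewrite rmorphN /= rC.
have polar : inner (T u) u - inner (T v) v = 4 * `|x| * `|T x|.
  by rewrite /u /v !quadE// -rTx; ring.
have para : `|u| ^+ 2 + `|v| ^+ 2 = 4 * `|x| ^+ 2.
  by rewrite /u /v !normE// -rTx; ring.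
have := le_trans (ler_normB (inner (T u) u) (inner (T v) v))
  (lerD (Tc u) (Tc v)).
rewrite polar -mulrDr para ger0_norm ?mulr_ge0//.
have -> : c * (4 * `|x| ^+ 2) = 4 * `|x| * (c * `|x|) by ring.
by rewrite ler_pM2l// mulr_gt0.
Qed.

(** * Operator norm and numerical radius *)

Lemma opnorm_le T (c : R) :
  (forall x, `|x| <= 1 -> `|T x| <= c%:C%C) -> opnorm T <= c.
Proof.
move=> Tc; apply: ge_sup.
  by exists (complex.Re `|T 0|), 0 => //=; rewrite normr0.
by move=> _ [x x1 <-]; exact: (Re_le (Tc x x1)).
Qed.

Lemma opnorm_le_of_bound T (c : R) : 0 <= c ->
  (forall x, `|T x| <= c%:C%C * `|x|) -> opnorm T <= c.
Proof.
move=> c0 Tc; apply: opnorm_le => x x1; apply: (le_trans (Tc x)).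
by rewrite ler_piMr// lecR.
Qed.

Lemma le_opnorm T : bounded_operator T ->
  forall x, `|x| <= 1 -> `|T x| <= (opnorm T)%:C%C.
Proof.
move=> [M TM] x x1; rewrite -normRe lecR.
apply: ub_le_sup; last by exists x.
(* Dropping the factor [|y| <= 1] requires a nonnegative constant, hence the absolute value. *)
exists `|M| => _ [y y1 <-]; apply: (@Re_le _ _ (`|M|%:C%C)).
apply: (le_trans (TM y)); apply: (@le_trans _ _ (`|M|%:C%C * `|y|)).
  by rewrite ler_wpM2r// lecR ler_norm.
by rewrite ler_piMr// lecR.
Qed.

Lemma opnorm_ge0 T : bounded_operator T -> 0 <= opnorm T.
Proof.
move=> /le_opnorm/(_ 0); rewrite normr0 => /(_ ler01) h.
by rewrite -lecR (le_trans _ h).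
Qed.

(** If the set of values is empty or unbounded, [sup] takes its default value 0. *)
Lemma numradius_ge0 (A : H -> H) : 0 <= numradius A.
Proof.
rewrite /numradius; set E := image _ _.
have [supE|/sup_out ->//] := pselect (has_sup E).
have [r Er] := supE.1; apply: (@le_trans _ _ r); last exact: ub_le_sup supE.2 _ Er.
by have [x _ <-] := Er; exact: (@Re_le _ 0).
Qed.

Lemma le_numradius (A : {linear H -> H}) : bounded_operator A ->
  forall x, `|inner (A x) x| <= (numradius A)%:C%C * `|x| ^+ 2.
Proof.
move=> [M AM] x.
have [->|x0] := eqVneq x 0; first by rewrite linear0r !normr0 expr0n mulr0.
have nx0 : 0 < `|x| by rewrite normr_gt0.
have Vreal : (`|x|^-1)^* = `|x|^-1 by apply/CrealP; rewrite ger0_real// invr_ge0.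
pose y := `|x|^-1 *: x.
have y1 : `|y| = 1 by rewrite normrZ normfV normr_id mulVf// gt_eqF.
have -> : `|inner (A x) x| = `|inner (A y) y| * `|x| ^+ 2.
  have -> : A y = `|x|^-1 *: A x by rewrite /y linearZ.
  rewrite /y innerZl innerZr Vreal !normrM normfV normr_id.
  by field; rewrite gt_eqF.
rewrite ler_wpM2r ?exprn_ge0// -[leLHS]RRe_real ?normr_real// lecR.
apply: ub_le_sup; last by exists y.
exists M => _ [z z1 <-]; apply: (@Re_le _ _ (M%:C%C)).
by apply: (le_trans (cauchy_schwarz _ _)); have := AM z; rewrite z1 !mulr1.
Qed.

(** * Norm estimates for [S] and [D] *)

Section adjoint.
Variable A : {linear H -> H}.
Hypothesis A_bounded : bounded_operator A.

Let S := A \+ adjoint A.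
Let D := A \- adjoint A.
Let w := numradius A.

Lemma adjointPr x y : inner (adjoint A x) y = inner x (A y).
Proof. by rewrite inner_conj -adjointP// -inner_conj. Qed.

(** [inner (S x) x] is [inner (A x) x] plus its conjugate, so its modulus is at most
    [2 * w * |x| ^+ 2]. *)
Lemma addadj_le x : `|S x| <= (2 * w)%:C%C * `|x|.
Proof.
apply: symmetric_norm_le => {x} [x y|x].
  by rewrite /S /= linearDl linearDr /= adjointP// adjointPr addrC.
rewrite /S /= linearDl /= adjointPr (inner_conj (A x) x).
apply: (le_trans (ler_normD _ _)); rewrite norm_conjC rmorphM rmorph_nat.
by rewrite -mulrA mulr2n mulrDl mul1r lerD// le_numradius.
Qed.

Lemma subadj_le x : `|D x| <= (2 * w)%:C%C * `|x|.
Proof.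
(* The factor ['i] makes the skew map [D] symmetric and preserves norms. *)
have -> : `|D x| = `|('i : C) *: D x| by rewrite normrZ normCi mul1r.
apply: (@symmetric_norm_le (fun x => ('i : C) *: D x)) => {x} [x y|x].
  rewrite innerZl innerZr /D /= conjCi linearBl linearBr /=.
  by rewrite adjointP// adjointPr; ring.
rewrite innerZl normrM normCi mul1r.
rewrite /D /= linearBl /= adjointPr (inner_conj (A x) x).
apply: (le_trans (ler_normB _ _)); rewrite norm_conjC rmorphM rmorph_nat.
by rewrite -mulrA mulr2n mulrDl mul1r lerD// le_numradius.
Qed.

(** Ensures that [opnorm S] is a genuine supremum, without a separate bound on [adjoint A]. *)
Lemma addadj_bounded : bounded_operator S.
Proof. by exists (2 * w); exact: addadj_le. Qed.

Lemma subadj_bounded : bounded_operator D.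
Proof. by exists (2 * w); exact: subadj_le. Qed.

Lemma opnorm_adjMD :
  opnorm ((adjoint A \o A) \+ (A \o adjoint A)) <=
  (opnorm S ^+ 2 + opnorm D ^+ 2) / 2.
Proof.
have s0 := opnorm_ge0 S addadj_bounded.
have d0 := opnorm_ge0 D subadj_bounded.
have sle := le_opnorm S addadj_bounded.
have dle := le_opnorm D subadj_bounded.
apply: opnorm_le => x x1 /=; set q := _ + _.
have [->|q0] := eqVneq q 0.
  by rewrite normr0 lecR divr_ge0// addr_ge0// sqr_ge0.
have nq0 : 0 < `|q| by rewrite normr_gt0.
(* Pairing with the unit vector along [q] recovers [|q|]. *)
pose y := `|q|^-1 *: q.
have y1 : `|y| = 1 by rewrite normrZ normfV normr_id mulVf// gt_eqF.
have Vreal : (`|q|^-1)^* = `|q|^-1 by apply/CrealP; rewrite ger0_real// invr_ge0.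
have qy : inner q y = `|q|.
  rewrite innerZr Vreal -sqr_norm_inner.
  by field; rewrite gt_eqF.
(* The mixed terms cancel; [inner (A x) (A y)] and [inner (adjoint A x) (adjoint A y)] remain, each
   twice, and add up to [2 * inner q y]. *)
have SD : inner (S x) (S y) + inner (D x) (D y) = 2 * `|q|.
  rewrite -qy /q /S /D /= !linearBl !linearBr !linearDl !linearDr /=.
  by rewrite (adjointPr (A x)) (adjointP A_bounded (adjoint A x)); ring.
have bound T (t : R) : 0 <= t -> (forall z, `|z| <= 1 -> `|T z| <= t%:C%C) ->
    `|inner (T x) (T y)| <= (t ^+ 2)%:C%C.
  move=> t0 Tt; apply: (le_trans (cauchy_schwarz _ _)).
  by rewrite rmorphXn expr2 ler_pM// Tt// y1.
have := le_trans (ler_normD _ _) (lerD (bound S _ s0 sle) (bound D _ d0 dle)).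
rewrite SD ger0_norm ?mulr_ge0// -rmorphD /= => h.
by rewrite rmorphM fmorphV rmorph_nat ler_pdivlMr// mulrC.
Qed.

End adjoint.
End operator_norms.

Theorem theorem2p13 (R : realType) (H : hilbertType R) (A : {linear H -> H})
    (A_bounded : bounded_operator A) :
  1 / 4 * opnorm ((adjoint A \o A) \+ (A \o adjoint A))
    <= 1 / (4 * Num.sqrt 2) *
       Num.sqrt (opnorm (A \+ adjoint A) ^+ 4 + opnorm (A \- adjoint A) ^+ 4)
    <= numradius A ^+ 2.
Proof.
have w0 := numradius_ge0 A.
have s0 := opnorm_ge0 _ (addadj_bounded A A_bounded).
have d0 := opnorm_ge0 _ (subadj_bounded A A_bounded).
have q_le := opnorm_adjMD A A_bounded.
have ww : 0 <= 2 * numradius A by rewrite mulr_ge0.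
have s_le := opnorm_le_of_bound _ _ ww (addadj_le A A_bounded).
have d_le := opnorm_le_of_bound _ _ ww (subadj_le A A_bounded).
(* Only inequalities between four real numbers remain. *)
move: (opnorm _) (opnorm _) (opnorm _) (numradius A) => q d s w
  in w0 s0 d0 q_le s_le d_le ww *.
have r0 : 0 < Num.sqrt 2 :> R by rewrite sqrtr_gt0.
have r2 : Num.sqrt 2 ^+ 2 = 2 :> R by rewrite sqr_sqrtr.
have sd0 : 0 <= s ^+ 4 + d ^+ 4 by rewrite addr_ge0// exprn_ge0.
have k0 : 0 < 4 * Num.sqrt 2 :> R by rewrite mulr_gt0.
rewrite [1 / (_ * _) * _]mulrAC !mul1r; apply/andP; split.
  rewrite ler_pdivlMr//.
  apply: (@le_trans _ _ ((s ^+ 2 + d ^+ 2) / 2 * Num.sqrt 2)); first nra.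
  rewrite -(ler_pXn2r (n := 2)) ?nnegrE ?sqrtr_ge0//; last first.
    by rewrite mulr_ge0 ?divr_ge0 ?addr_ge0 ?sqr_ge0// ltW.
  rewrite sqr_sqrtr// exprMn r2.
  (* The squared sides differ by [(s ^+ 2 - d ^+ 2) ^+ 2 / 2]. *)
  have := sqr_ge0 (s ^+ 2 - d ^+ 2); nra.
rewrite ler_pdivrMr// -(ler_pXn2r (n := 2)) ?nnegrE ?sqrtr_ge0//; last first.
  by rewrite mulr_ge0 ?sqr_ge0// ltW.
(* After squaring, the right side is [32 * w ^+ 4], which is twice [(2 * w) ^+ 4]. *)
have s4 : s ^+ 4 <= (2 * w) ^+ 4 by rewrite lerXn2r ?nnegrE.
have d4 : d ^+ 4 <= (2 * w) ^+ 4 by rewrite lerXn2r ?nnegrE.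
rewrite sqr_sqrtr// !exprMn r2.
by have := lerD s4 d4; lra.
Qed.
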